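(* For any integer $p$ there is an infinitely narrow soliton type solution of the Hopf equation $u_t+uu_x=0$ up to $e^{-p}$ in the sense of $\mathbf{R}\langle\varepsilon\rangle$-distributions, i.e. a function $$v(t,x,\varepsilon)=l_0+\Delta l\, \varphi\!\left(\frac{x-ct}{\varepsilon}\right),$$ with $l_0,\Delta l,c$ real numbers, $\Delta l\neq 0$, $\varphi\in\mathcal{S}(\mathbf{R})$, $\int_{-\infty}^{+\infty}\varphi(y)\,dy=1$, such that for every $t\in[0,T]$ and every $\psi\in\mathcal{S}(\mathbf{R})$, $$\int_{-\infty}^{+\infty}\{v_t(t,x,\varepsilon)+v(t,x,\varepsilon)v_x(t,x,\varepsilon)\}\psi(x)\,dx=\sum_{k=p}^{+\infty}\xi_k\varepsilon^k\in\mathbf{R}\langle\varepsilon\rangle .$$ Moreover, $$\frac{c-l_0}{\Delta l}=\frac12\int_{-\infty}^{+\infty}\varphi^2(x)\,dx.$$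
   Context: $\mathbf{R}\langle\varepsilon\rangle$ is the field of formal Laurent series $\sum_{n\ge 0}\xi_{n+k}\varepsilon^{n+k}$ ($k\in\mathbf{Z}$, $\xi_i\in\mathbf{R}$) with the non-Archimedean norm $|x|_\nu=e^{-\nu(x)}$, where $\nu(x)$ is the lowest exponent with nonzero coefficient ($\nu(0)=\infty$). An integral depending on $\varepsilon\in(0,1]$ is regarded as an element of $\mathbf{R}\langle\varepsilon\rangle$ via its expansion in powers of $\varepsilon$; ''solution up to $e^{-p}$'' means this element has the form $\sum_{k\ge p}\xi_k\varepsilon^k$ (norm at most $e^{-p}$). $T>0$ is a fixed time horizon and $\mathcal{S}(\mathbf{R})$ is the Schwartz space. *)

(* Defs.v *)
From HB Require Import structures.
From mathcomp Require Import all_boot all_order all_algebra.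
From mathcomp Require Import all_classical all_reals all_analysis.
Set Implicit Arguments. Unset Strict Implicit. Unset Printing Implicit Defensive.
Import Order.TTheory GRing.Theory Num.Theory.
Import numFieldNormedType.Exports.
Local Open Scope classical_set_scope.
Local Open Scope ring_scope.

Section Defs.
Variable R : realType.

Definition schwartz (f : R -> R) : Prop :=
  (forall (n : nat) (x : R), derivable (derive1n n f) x 1) /\
  (forall m n : nat, exists M : R, forall x : R, `|x ^+ m * derive1n n f x| <= M).

Definition line_integral (f : R -> R) : R := Rintegral (@lebesgue_measure R) setT f.

(* "F, regarded as an element of R<eps> via its expansion in powers of eps,
   has the form sum_{k >= p} xi_k eps^k": F admits, as eps -> 0+ (eps in (0,1]),
   the asymptotic expansion sum_{i>=0} a_i eps^(p+i), i.e. for every n the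
   remainder after the terms up to eps^(p+n) is O(eps^(p+n+1)). *)
Definition expansion_from (p : int) (F : R -> R) : Prop :=
  exists a : nat -> R, forall n : nat,
    exists C : R, exists delta : R, 0 < delta /\
      forall e : R, 0 < e -> e <= delta -> e <= 1 ->
        `|F e - \sum_(i < n.+1) a i * e ^ (p + (i : nat)%:Z)|
          <= C * e ^ (p + (n.+1)%:Z).

Definition soliton (l0 dl c : R) (phi : R -> R) (t x e : R) : R :=
  l0 + dl * phi ((x - c * t) / e).

Definition dt (v : R -> R -> R -> R) (t x e : R) : R := derive1 (fun s => v s x e) t.
Definition dx (v : R -> R -> R -> R) (t x e : R) : R := derive1 (fun y => v t y e) x.

End Defs.

(* Main.v *)
Require Import Defs.
From HB Require Import structures.
From mathcomp Require Import all_boot all_order all_algebra.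
From mathcomp Require Import all_classical all_reals all_analysis measurable_realfun.
From mathcomp Require Import zify ring lra.
Import Order.TTheory GRing.Theory Num.Theory.
Import numFieldNormedType.Exports.
Local Open Scope ring_scope.

(* A profile solving phi^2 - phi = w exactly is phi = (1 - sqrt (1 + 4 w)) / 2,
   which is Schwartz as soon as w is Schwartz and small.  With l0 = 0,
   dl = \int phi, c = 1/2 and profile phi / dl, the soliton is
   phi ((x - ct) / eps) and its residual in the Hopf equation is
   w' ((x - ct) / eps) / (2 eps).  Tested against psi and Taylor expanded at ct,
   this has coefficients proportional to the moments of w', so it is enough to
   take for w a small multiple of a high derivative of a Gaussian.  Then
   \int w = 0 as well, so that \int phi = \int phi^2, which is the relation
   between c, l0 and dl. *)

(** * Classes of bounded and rapidly decreasing functions, and Schwartz functions in terms of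
    them *)

Definition bounded_fct {R : realType} (f : R -> R) : Prop :=
  exists M : R, forall x, `|f x| <= M.

Definition rapid {R : realType} (f : R -> R) : Prop :=
  forall m : nat, bounded_fct (fun x => x ^+ m * f x).

(** The derivatives up to order [n] are existential witnesses rather than values of [derive1n], so
    closure properties follow by induction on [n] from explicit formulas for one derivative. The
    parameter [P] lets bounded and rapidly decreasing functions share these proofs. *)
Fixpoint smooth_upto {R : realType} (P : (R -> R) -> Prop) (n : nat)
    (f : R -> R) : Prop :=
  P f /\ if n is m.+1
         then exists2 f' : R -> R,
           (forall x : R, is_derive x 1 f (f' x)) & smooth_upto P m f'
         else True.

Section SmoothUpto.
Context {R : realType}.
Implicit Types (P Q : (R -> R) -> Prop) (f g : R -> R).

Lemma rapidMl f g :
  bounded_fct f -> rapid g -> rapid (fun x => f x * g x).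
Proof.
move=> [M fM] gr m; have [N gN] := gr m; exists (M * N) => x.
by rewrite mulrCA normrM ler_pM.
Qed.

Lemma rapid_bounded f : rapid f -> bounded_fct f.
Proof. by move=> /(_ 0) [M fM]; exists M => x; rewrite -[f x]mul1r fM. Qed.

Lemma bounded_fct_cst (c : R) : bounded_fct (fun _ : R => c).
Proof. by exists `|c|. Qed.

Lemma bounded_fctD f g :
  bounded_fct f -> bounded_fct g -> bounded_fct (fun x => f x + g x).
Proof.
move=> [M fM] [N gN]; exists (M + N) => x.
by rewrite (le_trans (ler_normD _ _))// lerD.
Qed.

Lemma bounded_fctM f g :
  bounded_fct f -> bounded_fct g -> bounded_fct (fun x => f x * g x).
Proof. by move=> [M fM] [N gN]; exists (M * N) => x; rewrite normrM ler_pM. Qed.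

Lemma rapidD f g : rapid f -> rapid g -> rapid (fun x => f x + g x).
Proof.
move=> fr gr m; have [M fgM] := bounded_fctD _ _ (fr m) (gr m).
by exists M => x; rewrite mulrDr.
Qed.

Lemma rapidXM k f : rapid f -> rapid (fun x => x ^+ k * f x).
Proof.
by move=> fr m; have [M fM] := fr (m + k)%N; exists M => x; rewrite mulrA -exprD.
Qed.

Lemma rapidZ (c : R) f : rapid f -> rapid (fun x => c * f x).
Proof. exact/rapidMl/bounded_fct_cst. Qed.

Lemma smooth_uptoW P n f : smooth_upto P n.+1 f -> smooth_upto P n f.
Proof.
elim: n f => [|n IH] f; first by case.
by case=> Pf [f' df /IH sf']; split => //; exists f'.
Qed.

Lemma smooth_upto_sub P Q n f : (forall f, P f -> Q f) ->
  smooth_upto P n f -> smooth_upto Q n f.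
Proof.
move=> PQ; elim: n f => [|n IH] f [/PQ Qf]; first by [].
by case=> f' df /IH sf'; split => //; exists f'.
Qed.

Lemma smooth_uptoD P n f g :
  (forall f g, P f -> P g -> P (fun x => f x + g x)) ->
  smooth_upto P n f -> smooth_upto P n g ->
  smooth_upto P n (fun x => f x + g x).
Proof.
move=> PD; elim: n f g => [|n IH] f g [Pf +] [Pg]; first by split => //; exact: PD.
case=> f' df sf' [g' dg sg']; split; first exact: PD.
by exists (fun x => f' x + g' x); [move=> x; apply: is_deriveD | exact: IH].
Qed.

(** Leibniz rule by induction. Two classes occur because bounded functions act as multipliers both
    on rapidly decreasing and on bounded ones. *)
Lemma smooth_uptoM P Q n f g :
  (forall f g, Q f -> Q g -> Q (fun x => f x + g x)) ->
  (forall f g, P f -> Q g -> Q (fun x => f x * g x)) ->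
  smooth_upto P n f -> smooth_upto Q n g ->
  smooth_upto Q n (fun x => f x * g x).
Proof.
move=> QD PQ; elim: n f g => [|n IH] f g sf sg.
  by split => //; apply: PQ; [case: sf | case: sg].
have sfn := smooth_uptoW _ _ _ sf; have sgn := smooth_uptoW _ _ _ sg.
case: sf sg => Pf [f' df sf'] [Qg [g' dg sg']].
split; first exact: PQ.
exists (fun x => f' x * g x + f x * g' x).
  by move=> x; apply: is_derive_eq; rewrite addrC [f' x * _]mulrC.
by apply: smooth_uptoD => //; exact: IH.
Qed.

Lemma smooth_upto_cst n (c : R) : smooth_upto bounded_fct n (fun _ => c).
Proof.
elim: n c => [|n IH] c; split; rewrite //; try exact: bounded_fct_cst.
by exists (fun _ => 0) => // x; exact: is_derive_cst.
Qed.

Lemma smooth_upto_rapidZ n (c : R) f :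
  smooth_upto rapid n f -> smooth_upto rapid n (fun x => c * f x).
Proof.
by apply: (smooth_uptoM bounded_fct) (smooth_upto_cst n c);
  [exact: rapidD | exact: rapidMl].
Qed.

(** The factor [x] is unbounded, so it is not a multiplier in the sense of [smooth_uptoM]; rapid
    decay absorbs it. *)
Lemma smooth_upto_rapidX n f :
  smooth_upto rapid n f -> smooth_upto rapid n (fun x => x * f x).
Proof.
elim: n f => [|n IH] f sf.
  by split => //; apply: (rapidXM 1); case: sf.
have sfn := smooth_uptoW _ _ _ sf.
case: sf => rf [f' df sf']; split; first exact: (rapidXM 1).
exists (fun x => f x + x * f' x).
  by move=> x; apply: is_derive_eq; rewrite addrC /GRing.scale/= mulr1.
by apply: smooth_uptoD => //; [exact: rapidD | exact: IH].
Qed.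

Lemma schwartzP f : schwartz f <-> forall n, smooth_upto rapid n f.
Proof.
split=> [[df rf] n|sf].
  rewrite -(derive1n0 f); move: 0%N => k.
  elim: n k => [|n IH] k; split => //; try by move=> m; exact: rf.
  exists (derive1n k.+1 f) => // x.
  by rewrite derive1nS derive1E; apply: derivableP.
(* Each derivative costs one order of smoothness, so the order [k] stays universally quantified in
   the induction. *)
have aux n : forall k, smooth_upto rapid k (derive1n n f).
  elim: n => [//|n IH] k; have [_ [f' df sf']] := IH k.+1.
  rewrite derive1nS; rewrite (_ : _^`()%classic = f') //.
  by apply/funext => x; rewrite derive1E; apply: derive_val.
split=> [n x|m n]; last by have [+ _] := aux n 0; exact.
by have [_ [f' /(_ x) df _]] := aux n 1%N; exact: ex_derive.
Qed.

Lemma schwartz_derive1 f : schwartz f -> schwartz (derive1 f).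
Proof.
case=> df rf; split=> [n x|m n]; rewrite -derive1Sn; [exact: df | exact: rf].
Qed.

Lemma schwartz_derive1n n f : schwartz f -> schwartz (derive1n n f).
Proof.
by move=> sf; elim: n => [//|n IH]; rewrite derive1nS; exact: schwartz_derive1.
Qed.

Lemma schwartz_rapid f : schwartz f -> rapid f.
Proof. by case=> _ rf m; exact: (rf m 0%N). Qed.

Lemma schwartz_is_derive f (x : R) : schwartz f -> is_derive x 1 f (derive1 f x).
Proof. by case=> /(_ 0%N x) df _; rewrite derive1E; exact: derivableP. Qed.

Lemma is_derive_continuous f f' :
  (forall x : R, is_derive x 1 f (f' x)) -> continuous f.
Proof.
by move=> df x; apply/differentiable_continuous/derivable1_diffP/ex_derive.
Qed.

Lemma schwartz_continuous f : schwartz f -> continuous f.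
Proof.
by move=> sf; apply: is_derive_continuous => x; exact: schwartz_is_derive.
Qed.

Lemma schwartzZ (c : R) f : schwartz f -> schwartz (fun x => c * f x).
Proof. by move=> /schwartzP sf; apply/schwartzP => n; exact: smooth_upto_rapidZ. Qed.

(** With [k = m + 1], which is nonzero, [exp (x^2) = exp (x^2 / k) ^ k >= (1 + x^2 / k) ^ k], and
    [k ^ k] times this dominates [(1 + x^2) ^ k], hence [|x| ^ m]. *)
Lemma gauss_rapid : rapid (@gauss_fun R).
Proof.
move=> m; exists (m.+1%:R ^+ m.+1) => x.
set k := m.+1; have k0 : 0 < k%:R :> R by rewrite ltr0n.
rewrite normrM (ger0_norm (gauss_fun_ge0 _)) /gauss_fun expRN.
rewrite ler_pdivrMr ?expR_gt0// normrX.
have x2 : 0 <= x ^+ 2 by exact: sqr_ge0.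
have h1 : `|x| ^+ m <= (1 + x ^+ 2) ^+ m.
  rewrite lerXn2r ?nnegrE ?addr_ge0//.
  by have := real_normK (num_real x) => <-; have := sqr_ge0 (`|x| - 1/2); lra.
have h2 : (1 + x ^+ 2) ^+ m <= (1 + x ^+ 2) ^+ k.
  by rewrite ler_weXn2l// lerDl.
apply: (le_trans h1); apply: (le_trans h2).
have -> : x ^+ 2 = k%:R * (x ^+ 2 / k%:R) by rewrite mulrCA divff ?mulr1// gt_eqF.
rewrite expRM_natl -exprMn.
rewrite ler_pXn2r ?nnegrE ?mulr_ge0 ?addr_ge0 ?expR_ge0 ?divr_ge0//.
apply: le_trans (ler_wpM2l (ltW k0) (expR_ge1Dx _)).
by rewrite mulrDr mulr1 lerD2r ler1n.
by rewrite mulr_ge0 ?divr_ge0 ?ler0n.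
Qed.

(** The derivative is [-2 x] times the Gaussian itself, so one more order of smoothness follows from
    closure under multiplication by [x]. *)
Lemma gauss_schwartz : schwartz (@gauss_fun R).
Proof.
apply/schwartzP; elim=> [|n IH]; first by split => //; exact: gauss_rapid.
split; first exact: gauss_rapid.
exists (fun x => -2 * (x * gauss_fun x)).
  move=> x; rewrite /gauss_fun; apply: is_derive_eq.
  by rewrite /GRing.scale/=; ring.
by apply: smooth_upto_rapidZ; exact: smooth_upto_rapidX.
Qed.

End SmoothUpto.

(** * Integration of continuous rapidly decreasing functions over the line *)

Section RapidIntegral.
Local Open Scope classical_set_scope.
Context {R : realType}.
Let mu := @lebesgue_measure R.
Implicit Types (f g : R -> R).

Lemma measurable_EFin_continuous f : continuous f ->
  measurable_fun setT (EFin \o f).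
Proof.
by move=> cf; apply/measurable_EFinP; exact: continuous_measurable_fun.
Qed.

(** This is the dominating function for all rapidly decreasing ones. By evenness its integral
    reduces to the known one over the half-line. *)
Lemma integrable_oneDsqrV :
  mu.-integrable setT (EFin \o (fun x : R => (oneDsqr x)^-1)).
Proof.
have m := measurable_EFin_continuous _ (@continuous_oneDsqrV R).
apply/integrableP; split => //; apply/abse_integralP => //=.
rewrite ge0_symfun_integralT.
- rewrite (_ : [set x | _] = `[0, +oo[%classic); last first.
    by apply/seteqP; split => x/=; rewrite in_itv/= andbT.
  by rewrite integral0y_oneDsqr -EFinM/= ltry.
- by move=> x; rewrite invr_ge0 (le_trans ler01)// oneDsqr_ge1.
- exact: continuous_oneDsqrV.
- by move=> x/=; rewrite /oneDsqr sqrrN.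
Qed.

(** The bounds [M] on [|f|] and [N] on [|x^2 f|] give [|f| <= (M + N) / (1 + x^2)]. *)
Lemma rapid_integrable f :
  continuous f -> rapid f -> mu.-integrable setT (EFin \o f).
Proof.
move=> cf rf; have [M fM] := rf 0%N; have [N fN] := rf 2%N.
have := @integrableZl _ _ _ mu setT measurableT (M + N) _ integrable_oneDsqrV.
apply: le_integrable => //.
  exact: measurable_EFin_continuous.
move=> x _ /=; rewrite lee_fin.
have x1 : 0 < oneDsqr x by rewrite (lt_le_trans ltr01)// oneDsqr_ge1.
have {}fM := fM x; have {}fN := fN x.
have M0 : 0 <= M by exact: le_trans fM.
have N0 : 0 <= N by exact: le_trans fN.
rewrite [leRHS]ger0_norm ?mulr_ge0 ?addr_ge0 ?invr_ge0 ?(ltW x1)//.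
rewrite ler_pdivlMr// -[oneDsqr x]gtr0_norm// -normrM mulrC /oneDsqr mulrDl.
by rewrite (le_trans (ler_normD _ _))// lerD.
Qed.

Lemma line_integralZ (c : R) f : continuous f -> rapid f ->
  line_integral (fun x => c * f x) = c * line_integral f.
Proof.
by move=> cf rf; rewrite /line_integral RintegralZl//; exact: rapid_integrable.
Qed.

Lemma line_integralD f g : continuous f -> rapid f -> continuous g -> rapid g ->
  line_integral (fun x => f x + g x) = line_integral f + line_integral g.
Proof.
by move=> cf rf cg rg; rewrite /line_integral RintegralD//; exact: rapid_integrable.
Qed.

Lemma le_norm_line_integral f g : continuous f -> rapid f ->
  continuous g -> rapid g ->
  (forall x, `|f x| <= g x) -> `|line_integral f| <= line_integral g.
Proof.
move=> cf rf cg rg fg; rewrite /line_integral.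
have fi := rapid_integrable _ cf rf.
apply: (le_trans (le_normr_Rintegral _ _)) => //.
apply: le_Rintegral => //; last exact: rapid_integrable.
exact: integrable_norm.
Qed.

(** Substitution is carried out for nonnegative integrands and applied to [|f| + f] and [|f|], whose
    difference is [f]. *)
Lemma line_integral_comp_affine (a e : R) f : 0 < e -> continuous f -> rapid f ->
  line_integral f = e * line_integral (fun y => f (a + e * y)).
Proof.
move=> e0 cf rf; pose F (y : R) := a + e * y.
have dF (y : R) : is_derive y 1 F e.
  by apply: is_derive_eq; rewrite /GRing.scale/=; ring.
have cF : continuous F by exact: is_derive_continuous dF.
have F'E : derive1 F = cst e.
  by apply/funext => y; rewrite derive1E derive_val.
have ge0 g : continuous g -> (forall x, 0 <= g x) ->
    (\int[mu]_x (g x)%:E = e%:E * \int[mu]_x (g (F x))%:E)%E.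
  move=> cg g0; rewrite (@increasing_ge0_integration_by_substitutionT _ F)//.
  - rewrite F'E -ge0_integralZl//.
    + by apply: eq_integral => x _; rewrite -EFinM mulrC.
    + apply: measurable_EFin_continuous => x.
      by apply: continuous_comp; [exact: cF | exact: cg].
    + by move=> x _; rewrite lee_fin.
    + by rewrite lee_fin ltW.
  - by move=> x y xy; rewrite /F ltrD2l ltr_pM2l.
  - by rewrite F'E; exact: cst_continuous.
  - by rewrite F'E; exact: is_cvg_cst.
  - by rewrite F'E; exact: is_cvg_cst.
  - apply/cvgrNyPle => A; near=> x; rewrite /F -lerBrDl -ler_pdivlMl//.
  - apply/cvgryPge => A; near=> x; rewrite /F -lerBlDl -ler_pdivrMl//.
have cfF : continuous (f \o F).
  by move=> x; apply: continuous_comp; [exact: cF | exact: cf].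
have cn g : continuous g -> continuous (fun x => `|g x|).
  by move=> cg x; apply: continuous_comp; [exact: cg | exact: norm_continuous].
have fi := rapid_integrable _ cf rf.
(* An infinite integral of [|f \o F|] would stay infinite after multiplication by [e], contradicting
   the integrability of [f]. *)
have fFi : mu.-integrable setT (EFin \o (f \o F)).
  apply/integrableP; split; first exact: measurable_EFin_continuous.
  case/integrableP: fi => _ /=; rewrite ge0//; last exact: cn.
  rewrite -[X in (X < _)%E -> _]/(_ * \int[mu]_x (`|f (F x)|)%:E)%E.
  rewrite [X in _ -> (X < _)%E]/=.
  move=> h; rewrite ltNge; apply/negP; rewrite leye_eq => /eqP E.
  by move: h; rewrite E mulry gtr0_sg// mul1e ltxx.
have li0 g : continuous g -> (forall x, 0 <= g x) ->
    line_integral g = e * line_integral (g \o F).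
  move=> cg g0; rewrite /line_integral /Rintegral ge0//.
  have : (0 <= \int[mu]_x (g (F x))%:E)%E.
    by apply: integral_ge0 => x _; rewrite lee_fin.
  (* If the integral is [+oo], both sides are 0 because [fine] sends [+oo] to 0; nonnegativity
     excludes [-oo]. *)
  case: (\int[mu]_x _)%E => [r|_|//]; first by [].
  by rewrite mulry gtr0_sg// mul1e mulr0.
have := li0 (fun x => `|f x| + f x).
rewrite /line_integral RintegralD//; last exact: integrable_norm.
rewrite -/(line_integral (fun x => `|f x|)) li0//; last exact: cn.
rewrite [X in _ -> _ -> _ = e * X]RintegralD//; last exact: (integrable_norm fFi).
rewrite mulrDr => H; apply: (addrI (e * line_integral ((fun x => `|f x|) \o F))).
apply: H.
- by move=> x; apply: cvgD; [exact: (cn f cf x) | exact: cf].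
- by move=> x; have := ler_norm (- f x); rewrite normrN; lra.
Unshelve. all: by end_near. Qed.

Lemma rapid_norm_bound f : rapid f -> exists M, forall x : R, 0 < x ->
  `|f x| <= M / x /\ `|f (- x)| <= M / x.
Proof.
move=> /(_ 1%N)[M fM]; exists M => x x0; split; rewrite ler_pdivlMr//.
  by rewrite -{2}(gtr0_norm x0) -normrM mulrC; exact: fM.
by rewrite -[X in _ * X <= _](gtr0_norm x0) -(normrN x) -normrM mulrC; exact: fM.
Qed.

(** The fundamental theorem of calculus on growing symmetric intervals leaves boundary terms that
    tend to 0; dominated convergence passes to the whole line. *)
Lemma line_integral_derive f f' : (forall x : R, is_derive x 1 f (f' x)) ->
  continuous f' -> rapid f -> rapid f' -> line_integral f' = 0.
Proof.
move=> df cf' rf rf'.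
have cf : continuous f by exact: is_derive_continuous df.
have f'i := rapid_integrable _ cf' rf'.
(* The shift to [n.+1] makes the interval nondegenerate already for [n = 0]. *)
pose D n : set R := `[- n.+1%:R, n.+1%:R]%classic.
have mD n : measurable (D n) by exact: measurable_itv.
have f'_D : {ae mu, forall x, setT x ->
    ((EFin \o f') \_ (D n)) x @[n --> \oo] --> (EFin \o f') x}.
  apply/aeW => x _; apply: cvg_near_cst; near=> n.
  rewrite patchE mem_set//= /D/= in_itv/= -ler_norml.
  rewrite (@le_trans _ _ n%:R) ?ler_nat//.
  by near: n; exact: nbhs_infty_ger.
have f'_le : {ae mu, forall x n, setT x ->
    (`|((EFin \o f') \_ (D n)) x| <= (EFin \o (Num.norm \o f')) x)%E}.
  by apply/aeW => x n _; rewrite patchE; case: ifPn => //= _; rewrite normr0 lee_fin.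
have mf'D n : measurable_fun setT ((EFin \o f') \_ (D n)).
  apply/measurable_restrict => //.
  by apply: measurable_funTS; exact: measurable_EFin_continuous.
have [_ _] := @dominated_convergence _ (measurableTypeR R) R mu setT measurableT
  _ _ _ mf'D
  (measurable_EFin_continuous _ cf') f'_D (integrable_norm f'i) f'_le.
have -> : (fun n => \int[mu]_x ((EFin \o f') \_ (D n)) x)%E =
          (fun n => (f n.+1%:R - f (- n.+1%:R))%:E).
  apply/funext => n; rewrite -integral_mkcond.
  rewrite (@continuous_FTC2 _ f' f)//.
  - by rewrite -subr_gt0 opprK addr_gt0.
  - exact: continuous_subspaceT.
  - split; [by move=> x _; exact: ex_derive | exact/cvg_at_right_filter/cf |
            exact/cvg_at_left_filter/cf].
  - by move=> x _; rewrite derive1E derive_val.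
have [M fM] := rapid_norm_bound _ rf.
have M0 : 0 <= M.
  have [+ _] := fM 1 ltr01; rewrite divr1; exact: le_trans.
have f0 : (f n.+1%:R - f (- n.+1%:R))%:E @[n --> \oo] --> 0%E.
  apply: cvg_EFin; first by near=> n.
  apply/cvgrPdist_le => /= r r0; near=> n.
  rewrite sub0r normrN (le_trans (ler_normB _ _))//.
  have [|h1 h2] := fM n.+1%:R; first by rewrite ltr0n.
  apply: (le_trans (lerD h1 h2)); rewrite -mulrDl ler_pdivrMr ?ltr0n// mulrC.
  rewrite -ler_pdivrMr// (@le_trans _ _ n%:R) ?ler_nat//.
  by near: n; exact: nbhs_infty_ger.
by move=> /(cvg_unique _ f0); rewrite /line_integral /Rintegral => <-.
Unshelve. all: by end_near. Qed.

(** With [line_integral_ae0], this serves to show that the profile has nonzero integral. *)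
Lemma line_integral_sqr_eq0 f : continuous f -> rapid f ->
  line_integral (fun x => f x ^+ 2) = 0 -> {ae mu, forall x, f x = 0}.
Proof.
move=> cf rf; set g := fun x => f x ^+ 2 => g0.
have cg : continuous g by move=> x; apply: cvgM; exact: cf.
have rg : rapid g by apply: rapidMl => //; exact: rapid_bounded.
have gi := rapid_integrable _ cg rg.
have [+ _] := @ae_eq_integral_abs _ (measurableTypeR R) R mu setT measurableT
  _ (measurable_EFin_continuous _ cg).
have -> : (\int[mu]_x `|(EFin \o g) x| = 0)%E.
  rewrite -[RHS]/(0%:E) -g0 /line_integral /Rintegral fineK.
    by apply: eq_integral => x _ /=; rewrite ger0_norm ?sqr_ge0.
  exact: integrable_fin_num.
move=> /(_ erefl); apply: filterS => x /(_ I) /= [] /eqP.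
by rewrite sqrf_eq0 => /eqP.
Qed.

Lemma line_integral_ae0 f g : continuous g ->
  {ae mu, forall x, f x = 0} -> (forall x, f x = 0 -> g x = 0) ->
  line_integral g = 0.
Proof.
move=> cg [N [mN N0 fN]] fg; rewrite /line_integral /Rintegral.
rewrite (@ae_eq_integral _ (measurableTypeR R) R mu setT (cst 0%E)) ?integral0//.
  exact: measurable_EFin_continuous.
exists N; split => // x /= gx; apply: fN => /= /fg gx0.
by apply: gx => _; rewrite gx0.
Qed.

End RapidIntegral.

(** * Moments of derivatives of Schwartz functions *)

Section Expansion.
Context {R : realType}.
Implicit Types (f g u psi : R -> R).

Lemma continuous_XM k f : continuous f -> continuous (fun x : R => x ^+ k * f x).
Proof. by move=> cf x; apply: cvgM; [exact: exprn_continuous | exact: cf]. Qed.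

Lemma is_derive_exprn n (x : R) :
  is_derive x 1 (fun z : R => z ^+ n) (n%:R * x ^+ n.-1).
Proof.
have := is_deriveX n (is_derive_id x (1 : R)).
by rewrite exprfctE [_ *: _]mulr1.
Qed.

(** Integration by parts: the derivative of [x ^+ k * f x] has integral 0. For [k = 0] the truncated
    exponent [k.-1] is harmless, as its factor [k%:R] vanishes. *)
Lemma moment_derive1 k f : schwartz f ->
  line_integral (fun x => x ^+ k * derive1 f x) =
  - (k%:R * line_integral (fun x => x ^+ k.-1 * f x)).
Proof.
move=> sf; have sf' := schwartz_derive1 _ sf.
have cf := schwartz_continuous _ sf; have rf := schwartz_rapid _ sf.
have cf' := schwartz_continuous _ sf'; have rf' := schwartz_rapid _ sf'.
have c1 := continuous_XM k.-1 _ cf; have r1 := rapidXM k.-1 _ rf.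
have c2 := continuous_XM k _ cf'; have r2 := rapidXM k _ rf'.
have c3 : continuous (fun x : R => k%:R * (x ^+ k.-1 * f x)).
  by move=> x; apply: cvgM; [exact: cvg_cst | exact: c1].
have r3 := rapidZ k%:R _ r1.
apply/eqP; rewrite -addr_eq0 addrC -line_integralZ// -line_integralD//; apply/eqP.
apply: (@line_integral_derive _ (fun x => x ^+ k * f x)).
- move=> x; have df := schwartz_is_derive _ x sf; have dX := is_derive_exprn k x.
  by apply: is_derive_eq; rewrite /GRing.scale/=; ring.
- by move=> x; apply: cvgD; [exact: c3 | exact: c2].
- exact: rapidXM.
- exact: rapidD.
Qed.

(** Each integration by parts lowers both [k] and [n]; as [k < n], the exponent reaches 0 while a
    derivative is left, and the factor [k%:R] is then 0. *)
Lemma moment_derive1n_lt n k f : schwartz f -> (k < n)%N ->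
  line_integral (fun x => x ^+ k * derive1n n f x) = 0.
Proof.
move=> sf; elim: n k => [//|n IH] k kn.
rewrite derive1nS moment_derive1; last exact: schwartz_derive1n.
by case: k kn => [|k] kn; rewrite ?mul0r ?IH// ?mulr0 oppr0.
Qed.

Lemma moment_derive1n_eq n f : schwartz f ->
  line_integral (fun x => x ^+ n * derive1n n f x) =
  (-1) ^+ n * n`!%:R * line_integral f.
Proof.
move=> sf; elim: n => [|n IH].
  by rewrite fact0 !mul1r; congr line_integral; apply/funext => x; rewrite mul1r.
rewrite derive1nS moment_derive1; last exact: schwartz_derive1n.
by rewrite IH factS natrM exprS; ring.
Qed.

(** * Uniform Taylor expansion and asymptotic expansions in powers of [e] *)

Lemma is_derive_exp_sum n (c : nat -> R) (z : R) :
  is_derive z 1 (fun z : R => \sum_(k < n.+1) c k / k`!%:R * z ^+ k)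
                (\sum_(k < n) c k.+1 / k`!%:R * z ^+ k).
Proof.
elim: n => [|n IH].
  rewrite big_ord0; under eq_fun do rewrite big_ord1 expr0 mulr1.
  exact: is_derive_cst.
under eq_fun do rewrite big_ord_recr/=; rewrite big_ord_recr/=.
apply: is_deriveD; have dX := is_derive_exprn n.+1 z.
apply: is_derive_eq; rewrite /GRing.scale/= factS natrM.
by field; rewrite !pnatr_eq0 -lt0n fact_gt0 nat1r pnatr_eq0.
Qed.

(** Mean value theorem between 0 and [z]: the intermediate point [c] satisfies [|c| <= |z|], so the
    same [M] serves. *)
Lemma le_norm_derive n (M : R) g g' : (forall z : R, is_derive z 1 g (g' z)) ->
  g 0 = 0 -> (forall z, `|g' z| <= M * `|z| ^+ n) ->
  forall z, `|g z| <= M * `|z| ^+ n.+1.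
Proof.
move=> dg g0 g'M z; have cg := is_derive_continuous _ _ dg.
have M0 : 0 <= M.
  by have := le_trans (normr_ge0 _) (g'M 1); rewrite normr1 expr1n mulr1.
have key c : `|c| <= `|z| -> `|g z| = `|g' c| * `|z| -> `|g z| <= M * `|z| ^+ n.+1.
  move=> cz ->; rewrite exprSr mulrA ler_wpM2r//.
  by rewrite (le_trans (g'M c))// ler_wpM2l// lerXn2r ?nnegrE.
have [z0|z0] := leP 0 z.
  have [c] := MVT_segment z0 (fun x _ => dg x) (continuous_subspaceT cg).
  rewrite in_itv/= g0 !subr0 => /andP[c0 cz] gz; apply: (key c).
    by rewrite !ger0_norm.
  by rewrite gz normrM.
have [c] := MVT_segment (ltW z0) (fun x _ => dg x) (continuous_subspaceT cg).
rewrite in_itv/= g0 !sub0r => /andP[zc c0] gz; apply: (key c).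
  by rewrite !ler0_norm ?lerN2 // ltW.
by rewrite -normrN gz normrM normrN.
Qed.

(** The [z]-derivative of the remainder of order [n + 1] of [psi] is the remainder of order [n] of
    [psi']. The constant is thus inherited unchanged from a bound on the [n]-th derivative, which
    makes it uniform in [a]. *)
Lemma schwartz_taylor n psi : schwartz psi -> exists M : R, forall a z : R,
  `|psi (a + z) - \sum_(k < n) derive1n k psi a / k`!%:R * z ^+ k|
    <= M * `|z| ^+ n.
Proof.
elim: n psi => [|n IH] psi spsi.
  have [M psiM] := rapid_bounded _ (schwartz_rapid _ spsi).
  by exists M => a z; rewrite big_ord0 subr0 mulr1.
have [M psiM] := IH _ (schwartz_derive1 _ spsi).
exists M => a; apply: le_norm_derive (psiM a).
- move=> z; apply: is_deriveB.
    have dpsi := schwartz_is_derive _ (a + z) spsi.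
    by apply: is_derive_eq; rewrite /GRing.scale/=; ring.
  under eq_bigr do rewrite -derive1Sn.
  exact: (is_derive_exp_sum _ (fun k => derive1n k psi a)).
- rewrite addr0 big_ord_recl/= big1 ?addr0 => [|i _].
    by rewrite fact0 divr1 mulr1 subrr.
  by rewrite expr0n/= mulr0.
Qed.

(** Reindexes an expansion in natural powers of [e] to one starting at the integer [p], which may be
    negative. *)
Lemma expansion_from_power_series (P : nat) (p : int) (b : nat -> R) (F : R -> R) :
  p <= P%:Z -> (forall k, (k < P)%N -> b k = 0) ->
  (forall n, exists C : R, forall e : R, 0 < e -> e <= 1 ->
     `|F e - \sum_(k < n) b k * e ^+ k| <= C * e ^+ n) ->
  expansion_from p F.
Proof.
move=> pP b0 FC.
(* Negative powers get coefficient 0, and [N n] is [p + n] truncated at 0. If [p > 0], the terms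
   below [p] are lost in the reindexing, but they vanish as [p <= P]. *)
pose a (i : nat) := if 0 <= p + i%:Z then b (absz (p + i%:Z)) else 0.
pose N (n : nat) := if 0 <= p + n%:Z then (absz (p + n%:Z)) else 0%N.
have sumE e n : 0 < e ->
    \sum_(i < n) a i * e ^ (p + i%:Z) = \sum_(k < N n) b k * e ^+ k.
  move=> e0; elim: n => [|n IH].
    rewrite big_ord0 big1// => k _; rewrite b0 ?mul0r//.
    apply: (leq_trans (ltn_ord k)); rewrite /N addr0; case: ifP => // p0.
    by rewrite -lez_nat gez0_abs.
  rewrite big_ord_recr/= IH /a /N.
  have [pn|pn] := leP 0 (p + n%:Z).
    have -> : p + n.+1%:Z = (absz (p + n%:Z)).+1%:Z.
      by rewrite -[in RHS]addn1 PoszD gez0_abs// -addn1 PoszD addrA.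
    by rewrite le0z_nat absz_nat big_ord_recr/= -[X in _ ^ X](gez0_abs pn) -exprnP.
  rewrite mul0r addr0 big_ord0; case: ifP => pn1; last by rewrite big_ord0.
  have -> : p + n.+1%:Z = 0 by lia.
  by rewrite big_ord0.
exists a => n; have [C FCe] := FC (N n.+1).
exists C, 1; split => // e e0 e1 _.
rewrite sumE//; apply: (le_trans (FCe e e0 e1)).
have C0 : 0 <= C.
  by have := le_trans (normr_ge0 _) (FCe 1 ltr01 (lexx 1)); rewrite expr1n mulr1.
rewrite ler_wpM2l// /N; case: ifPn => [pn|].
  by rewrite exprnP gez0_abs.
(* Here the target exponent is negative, and [e <= 1] gives [1 <= e ^ (p + n.+1)]. *)
rewrite -ltNge expr0 => pn.
rewrite -[X in e ^ X]opprK -(ltz0_abs pn) -exprnN invf_ge1 ?exprn_gt0//.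
by apply: exprn_ile1 => //; exact: ltW.
Qed.

(** Substituting [x = a + e y] gives the integral of [u y * psi (a + e y)]. Taylor expansion of
    [psi] at [a] makes the coefficient of [e ^+ k] a multiple of the [k]-th moment of [u]. *)
Lemma line_integral_mollified_expansion (P : nat) (p : int) u psi (a : R) :
  p <= P%:Z -> continuous u -> rapid u ->
  (forall k, (k < P)%N -> line_integral (fun x => x ^+ k * u x) = 0) ->
  schwartz psi ->
  expansion_from p
    (fun e => line_integral (fun x => e^-1 * u ((x - a) / e) * psi x)).
Proof.
move=> pP cu ru u0 spsi.
pose c k := derive1n k psi a / k`!%:R.
apply: (@expansion_from_power_series P p
  (fun k => c k * line_integral (fun x => x ^+ k * u x))) => //.
  by move=> k kP; rewrite u0 ?mulr0.
move=> n; have [M psiM] := schwartz_taylor n _ spsi.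
exists (M * line_integral (fun x => `|x ^+ n * u x|)) => e e0 _.
have cpsi := schwartz_continuous _ spsi.
have bpsi := rapid_bounded _ (schwartz_rapid _ spsi).
(* Taylor terms are removed one at a time, so that continuity, decay and the value of the integral
   of [r m] all follow by induction on [m]. *)
pose r m y := u y * (psi (a + e * y) - \sum_(k < m) c k * (e * y) ^+ k).
have rS m : r m.+1 = (fun y => r m y + - (c m * e ^+ m) * (y ^+ m * u y)).
  by apply/funext => y; rewrite /r big_ord_recr/= exprMn; ring.
have r0 : r 0%N = (fun y => u y * psi (a + e * y)).
  by apply/funext => y; rewrite /r big_ord0 subr0.
have ca : continuous (fun y : R => a + e * y).
  move=> y; apply: cvgD; first exact: cvg_cst.
  by apply: cvgM; [exact: cvg_cst | exact: cvg_id].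
have rP m : continuous (r m) /\ rapid (r m).
  elim: m => [|m [cr rr]].
    rewrite r0; split.
      move=> y; apply: cvgM; first exact: cu.
      exact: (continuous_comp (ca y) (cpsi _)).
    rewrite (_ : (fun _ => _) = (fun y => psi (a + e * y) * u y)).
      apply: rapidMl => //.
      by case: bpsi => N psiN; exists N => y.
    by apply/funext => y; rewrite mulrC.
  rewrite rS; split.
    move=> y; apply: cvgD; first exact: cr.
    apply: cvgM; [exact: cvg_cst | exact: continuous_XM].
  by apply: rapidD => //; apply: rapidZ; exact: rapidXM.
have intr m : line_integral (r m) =
    line_integral (fun x => e^-1 * u ((x - a) / e) * psi x) -
    \sum_(k < m) c k * line_integral (fun x => x ^+ k * u x) * e ^+ k.
  elim: m => [|m IH].
    rewrite big_ord0 subr0 r0 [RHS](@line_integral_comp_affine _ a e)//.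
    - have [cr rr] := rP 0%N; rewrite r0 in cr rr.
      rewrite [X in _ = e * X](_ : _ =
          line_integral (fun y => e^-1 * (u y * psi (a + e * y)))).
        by rewrite line_integralZ// mulrA divff ?gt_eqF// mul1r.
      congr line_integral; apply/funext => y; rewrite mulrA.
      by congr (_ * u _ * _); field; rewrite gt_eqF.
    - move=> x; apply: cvgM; last exact: cpsi.
      apply: cvgM; first exact: cvg_cst.
      apply: continuous_comp; last exact: cu.
      by apply: cvgM; [apply: cvgB; [exact: cvg_id | exact: cvg_cst] | exact: cvg_cst].
    - apply: rapidMl; last exact: schwartz_rapid.
      apply: (bounded_fctM (fun=> e^-1)); first exact: bounded_fct_cst.
      by case: (rapid_bounded _ ru) => N uN; exists N => x.
  have [cr rr] := rP m.
  rewrite rS line_integralD//.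
  - rewrite line_integralZ; [|exact: continuous_XM|exact: rapidXM].
    by rewrite IH big_ord_recr/=; ring.
  - by move=> y; apply: cvgM; [exact: cvg_cst | exact: continuous_XM].
  - by apply: rapidZ; exact: rapidXM.
have [cr rr] := rP n.
have cn : continuous (fun x : R => `|x ^+ n * u x|).
  by move=> x; apply: cvg_norm; exact: continuous_XM.
have rn : rapid (fun x : R => `|x ^+ n * u x|).
  move=> m; have [N uN] := rapidXM n _ ru m.
  by exists N => x; rewrite normrM normr_id -normrM.
rewrite -intr mulrAC -line_integralZ//.
apply: le_norm_line_integral => //.
- by move=> x; apply: cvgM; [exact: cvg_cst | exact: cn].
- exact: rapidZ.
move=> y; rewrite /r normrM mulrC.
apply: le_trans (ler_wpM2r (normr_ge0 _) (psiM a (e * y))) _.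
rewrite !normrM (gtr0_norm e0) exprMn normrX le_eqVlt; apply/orP; left.
by apply/eqP; ring.
Qed.

(** * Construction of the profile *)

(** The bound on [w] keeps the square root [S] away from 0. Then [phi' = - w' / S] is a Schwartz
    function times one with bounded derivatives of all orders. *)
Lemma quadratic_profile (w : R -> R) : schwartz w -> (forall x : R, `|w x| <= 8^-1) ->
  exists2 phi : R -> R, schwartz phi & forall x, phi x ^+ 2 - phi x = w x.
Proof.
move=> sw w8; pose S x := Num.sqrt (1 + 4 * w x); pose phi x := (1 - S x) / 2.
have S2 x : 2^-1 <= 1 + 4 * w x by have := w8 x; rewrite ler_norml; lra.
have S0 x : 0 < 1 + 4 * w x by apply: lt_le_trans (S2 x); rewrite invr_gt0.
have SS x : S x ^+ 2 = 1 + 4 * w x by rewrite sqr_sqrtr// ltW.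
have Sgt0 x : 0 < S x by rewrite sqrtr_gt0.
have Sge x : 2^-1 <= S x.
  by rewrite leNgt; apply/negP => S12; have := S2 x; rewrite -SS; have := Sgt0 x; nra.
have phiw x : phi x ^+ 2 - phi x = w x.
  by rewrite /phi; have := SS x => E; field: E.
pose I x := (S x)^-1; pose w' := derive1 w.
have sw' := schwartz_derive1 _ sw.
have dS x : is_derive (x : R) 1 S (2 * (w' x * I x)).
  have dw := schwartz_is_derive _ x sw.
  have dsq := is_derive1_sqrt (S0 x).
  apply: is_derive_eq; rewrite /GRing.scale/= -/(S x) /I /w'.
  by field; rewrite gt_eqF.
have dI x : is_derive (x : R) 1 I (-2 * (w' x * (I x * (I x * I x)))).
  have Sn0 : S x != 0 by rewrite gt_eqF.
  have := is_deriveV Sn0 (dS x).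
  by move/is_derive_eq; apply; rewrite /GRing.scale/= /I; field.
(* The derivative [-2 w' I^3] is a polynomial in [w'] and [I], so the induction closes up. *)
have regI n : smooth_upto bounded_fct n I.
  have bI : bounded_fct I.
    exists 2 => x; rewrite gtr0_norm ?invr_gt0//.
    by rewrite -[leRHS]invrK lef_pV2 ?posrE ?invr_gt0.
  elim: n => [//|n IH]; split => //.
  exists (fun x => -2 * (w' x * (I x * (I x * I x)))) => //.
  have bM f g := smooth_uptoM bounded_fct bounded_fct n f g bounded_fctD bounded_fctM.
  apply: (bM); first exact: smooth_upto_cst.
  apply: (bM); last by apply: (bM) => //; exact: (bM).
  by move/schwartzP: sw' => /(_ n); apply: smooth_upto_sub; exact: rapid_bounded.
(* Since [w = phi (phi - 1)] and [|phi - 1| = (1 + S) / 2 >= 1/2], the decay of [w] passes to [phi]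
   at the cost of a factor 2. *)
have rphi : rapid phi.
  move=> m; have [M wM] := schwartz_rapid _ sw m; exists (M * 2) => x.
  have h : 2^-1 <= `|phi x - 1|.
    by rewrite ler0_norm /phi; have := Sgt0 x; lra.
  rewrite -ler_pdivrMr//; apply: le_trans (wM x).
  have -> : x ^+ m * w x = x ^+ m * phi x * (phi x - 1) by rewrite -phiw; ring.
  by rewrite [leRHS]normrM ler_wpM2l.
exists phi => //; apply/schwartzP => -[|n]; split => //.
exists (fun x => -1 * (I x * w' x)).
  by move=> x; apply: is_derive_eq; rewrite /GRing.scale/=; field.
apply: smooth_upto_rapidZ; apply: (smooth_uptoM bounded_fct) => //.
- exact: rapidD.
- exact: rapidMl.
- by move/schwartzP: sw'.
Qed.

Lemma line_integral_gauss_neq0 : line_integral (@gauss_fun R) != 0.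
Proof.
by rewrite /line_integral /Rintegral integralT_gauss/= gt_eqF// sqrtr_gt0 pi_gt0.
Qed.

Lemma exists_profile (P : nat) : exists phi u : R -> R,
  [/\ schwartz phi, line_integral phi != 0,
      line_integral (fun x => phi x ^+ 2) = line_integral phi,
      continuous u /\ rapid u &
      (forall x, (phi x - 2^-1) * derive1 phi x = u x) /\
      (forall k, (k < P)%N -> line_integral (fun x => x ^+ k * u x) = 0)].
Proof.
(* Order [P.+1] rather than [P] makes the integral of [g] vanish even when [P = 0]. *)
pose g := derive1n P.+1 (@gauss_fun R).
have sg : schwartz g by apply: schwartz_derive1n; exact: gauss_schwartz.
have cg := schwartz_continuous _ sg; have rg := schwartz_rapid _ sg.
have [B gB] := rapid_bounded _ rg.
have B0 : 0 <= B by exact: le_trans (normr_ge0 _) (gB 0).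
(* This scales [g] below [1/8]; the summand 1 keeps the denominator positive when [B = 0]. *)
pose d := (8 * (B + 1))^-1.
have d0 : 0 < d by rewrite invr_gt0 mulr_gt0// ltr_wpDl.
pose w x := d * g x.
have sw : schwartz w by exact: schwartzZ.
have w8 x : `|w x| <= 8^-1.
  rewrite normrM gtr0_norm// /d invfM -mulrA ler_piMr// mulrC ler_pdivrMr ?mul1r.
    by rewrite (le_trans (gB x))// lerDl.
  by rewrite ltr_wpDl.
have [phi sphi phiw] := quadratic_profile w sw w8.
have cphi := schwartz_continuous _ sphi; have rphi := schwartz_rapid _ sphi.
have sg' := schwartz_derive1 _ sg.
have cg' := schwartz_continuous _ sg'; have rg' := schwartz_rapid _ sg'.
have int_w : line_integral w = 0.
  rewrite /w line_integralZ//.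
  have := moment_derive1n_lt P.+1 0 _ gauss_schwartz isT.
  by under eq_fun do rewrite expr0 mul1r; rewrite -/g => ->; rewrite mulr0.
have int_phi2 : line_integral (fun x => phi x ^+ 2) = line_integral phi.
  rewrite -[RHS]addr0 -int_w -line_integralD//.
  - by congr line_integral; apply/funext => x; rewrite -phiw; ring.
  - exact: schwartz_continuous.
  - exact: schwartz_rapid.
exists phi, (fun x => d / 2 * derive1 g x); split => //.
(* Otherwise [phi], and with it [g], would vanish almost everywhere, whereas the moment of order
   [P.+1] of [g] is, up to sign, [(P.+1)!] times the nonzero Gaussian integral. *)
- apply/negP => /eqP phi0; move: int_phi2; rewrite phi0.
  move=> /(line_integral_sqr_eq0 _ cphi rphi) ae0.
  have : line_integral (fun x => x ^+ P.+1 * g x) = 0.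
    apply: (line_integral_ae0 _ _ _ ae0) => [|x phix0]; first exact: continuous_XM.
    apply/eqP; rewrite mulf_eq0; apply/orP; right.
    by have /eqP := phiw x; rewrite phix0 expr0n subr0 eq_sym mulf_eq0 gt_eqF.
  apply/eqP; rewrite moment_derive1n_eq; last exact: gauss_schwartz.
  by rewrite !mulf_neq0 ?line_integral_gauss_neq0 ?signr_eq0//
    pnatr_eq0 -lt0n fact_gt0.
- split; last exact: rapidZ.
  by move=> x; apply: cvgM; [exact: cvg_cst | exact: cg'].
- split=> [x|k kP].
    have dphi := schwartz_is_derive _ x sphi.
    have dg := schwartz_is_derive _ x sg.
    have dw' : is_derive x 1 w (d * derive1 g x).
      by apply: is_derive_eq; rewrite /GRing.scale/=; ring.
    (* Differentiating [w] both as [d * g] and as [phi^2 - phi] gives [(2 phi - 1) phi' = d g']. *)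
    have dw : is_derive x 1 w (2 * phi x * derive1 phi x - derive1 phi x).
      have -> : w = (fun x => phi x ^+ 2 - phi x) by apply/funext => y; rewrite phiw.
      by apply: is_derive_eq; rewrite /GRing.scale/=; ring.
    have : 2 * phi x * derive1 phi x - derive1 phi x = d * derive1 g x.
      by rewrite -(@derive_val _ _ _ _ _ _ _ dw) -(@derive_val _ _ _ _ _ _ _ dw').
    by move=> h; rewrite mulrAC -h; field.
  under eq_fun do rewrite mulrCA.
  rewrite line_integralZ; [|exact: continuous_XM|exact: rapidXM].
  rewrite /g -derive1nS moment_derive1n_lt ?mulr0//; first exact: gauss_schwartz.
  by rewrite ltnS ltnW// ltnS ltnW.
Qed.

End Expansion.

(** * The soliton and its residual *)

Theorem theorem2 (R : realType) (T : R) (hT : 0 < T) (p : int) :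
  exists (l0 dl c : R) (phi : R -> R),
    dl != 0 /\ schwartz phi /\ line_integral phi = 1 /\
    (forall t : R, 0 <= t -> t <= T ->
       forall psi : R -> R, schwartz psi ->
         expansion_from p (fun e =>
           line_integral (fun x =>
             (dt (soliton l0 dl c phi) t x e
              + soliton l0 dl c phi t x e * dx (soliton l0 dl c phi) t x e)
             * psi x))) /\
    (c - l0) / dl = 1 / 2 * line_integral (fun x => phi x ^+ 2).
Proof.
(* The absolute value of [p] is a natural number that is at least [p], whatever the sign of [p]. *)
have [phi [u [sphi M0 int_phi2 [cu ru] [phiu u0]]]] := @exists_profile R (absz p).
have cphi := schwartz_continuous _ sphi; have rphi := schwartz_rapid _ sphi.
set M := line_integral phi in M0 int_phi2.
exists 0, M, 2^-1, (fun x => M^-1 * phi x); split => //; split; first exact: schwartzZ.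
split; first by rewrite line_integralZ// mulVf.
split=> [t _ _ psi spsi|].
  have solE : soliton 0 M 2^-1 (fun x => M^-1 * phi x) =
      (fun t x e => phi ((x - 2^-1 * t) / e)).
    apply/funext => s; apply/funext => x; apply/funext => e.
    by rewrite /soliton mulrA divff// mul1r add0r.
  rewrite solE.
  have -> : (fun e : R => line_integral (fun x =>
      (dt (fun t x e => phi ((x - 2^-1 * t) / e)) t x e + phi ((x - 2^-1 * t) / e) *
       dx (fun t x e => phi ((x - 2^-1 * t) / e)) t x e) * psi x)) =
      (fun e => line_integral (fun x => e^-1 * u ((x - 2^-1 * t) / e) * psi x)).
    apply/funext => e; congr line_integral; apply/funext => x; congr (_ * _).
    rewrite -phiu /dt /dx !derive1E.
    (* The functions of [e] are compared at every real [e], including 0. With the inverse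
       generalized to [i], the chain rule turns the residual into [i * (phi y - 1/2) * phi' y] in
       all cases. *)
    move: (e^-1) => i; set y := (x - 2^-1 * t) * i.
    have dphi : is_derive y 1 phi (derive1 phi y) by exact: schwartz_is_derive.
    have dt_phi : is_derive t 1 (fun s : R => phi ((x - 2^-1 * s) * i))
        (- (2^-1 * i) * derive1 phi y).
      apply: is_derive_eq; rewrite /GRing.scale/=; ring.
    have dx_phi : is_derive x 1 (fun z : R => phi ((z - 2^-1 * t) * i))
        (i * derive1 phi y).
      by apply: is_derive_eq; rewrite /GRing.scale/=; ring.
    rewrite (@derive_val _ _ _ _ _ _ _ dt_phi) (@derive_val _ _ _ _ _ _ _ dx_phi).
    by rewrite derive1E; ring.
  apply: (@line_integral_mollified_expansion _ (absz p)) => //.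
  exact: lez_abs.
under eq_fun do rewrite exprMn.
have cphi2 : continuous (fun x => phi x ^+ 2) by move=> x; apply: cvgM; exact: cphi.
have rphi2 : rapid (fun x => phi x ^+ 2).
  by apply: rapidMl => //; exact: rapid_bounded.
(* The integral of [(phi / M)^2] is [M / M^2], so both sides equal [1 / (2 M)]. *)
by rewrite line_integralZ// int_phi2 subr0; field.
Qed.
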